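(* Let $n\geq 1$ be an integer and let $x=(x_1,\ldots,x_n)\in\mathbb R^n$ be totally irrational, i.e., the $(n+1)$-tuple $(x_1,\ldots,x_n,1)$ is rationally independent (equivalently, $\operatorname{rank}(G_x)=n+1$). Then $\operatorname{orb}(x)$ is completely classified by $G_x$, that is, $\operatorname{orb}(x)=\{y\in\mathbb R^n\mid G_y=G_x\}$. In particular, if $x\in\mathbb R^2$ and $\operatorname{rank}(G_x)=3$, then $\operatorname{orb}(x)=\{y\in\mathbb R^2\mid G_y=G_x\}$.
   Context: $\mathcal G_n=GL(n,\mathbb Z)\ltimes\mathbb Z^n$ is the group of affine transformations of $\mathbb R^n$ of the form $x\mapsto Ux+t$, where $t\in\mathbb Z^n$ and $U$ is an integer $n\times n$ matrix with $\det(U)=\pm1$. For $x\in\mathbb R^n$, $\operatorname{orb}(x)=\{y\in\mathbb R^n\mid y=\gamma(x)\text{ for some }\gamma\in\mathcal G_n\}$. For $x=(x_1,\ldots,x_n)\in\mathbb R^n$, $G_x=\mathbb Z+\mathbb Zx_1+\cdots+\mathbb Zx_n$ is the subgroup of the additive group $\mathbb R$ generated by $1,x_1,\ldots,x_n$, and $\operatorname{rank}(G_x)$ is its rank as a free abelian group. Equality $G_y=G_x$ means equality as subsets of $\mathbb R$. *)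

(* Defs.v *)
From HB Require Import structures.
From mathcomp Require Import all_boot all_order all_algebra.
From mathcomp Require Import boolp classical_sets reals.
Set Implicit Arguments.
Unset Strict Implicit.
Unset Printing Implicit Defensive.
Import Order.TTheory GRing.Theory Num.Theory.
Local Open Scope classical_set_scope.
Local Open Scope ring_scope.

(* Points of R^n, and finite families of reals, are column vectors. *)

Definition affine_map (R : realType) (n : nat) (U : 'M[int]_n) (t : 'cV[int]_n)
    (x : 'cV[R]_n) : 'cV[R]_n :=
  map_mx intr U *m x + map_mx intr t.

(* GL(n, Z) |>< Z^n, as a set of transformations of R^n. *)
Definition affine_group (R : realType) (n : nat) : set ('cV[R]_n -> 'cV[R]_n) :=
  [set g | exists (U : 'M[int]_n) (t : 'cV[int]_n),
     (\det U = 1 \/ \det U = -1) /\ g = affine_map U t].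

Definition orb (R : realType) (n : nat) (x : 'cV[R]_n) : set 'cV[R]_n :=
  [set y | exists2 g, affine_group g & y = g x].

Definition Ggroup (R : realType) (n : nat) (x : 'cV[R]_n) : set R :=
  [set r | exists (a0 : int) (a : 'I_n -> int),
     r = a0%:~R + \sum_(i < n) (a i)%:~R * x i 0].

Definition rationally_independent (R : realType) (k : nat) (v : 'cV[R]_k) : Prop :=
  forall q : 'I_k -> rat,
    \sum_(i < k) ratr (q i) * v i 0 = 0 -> forall i, q i = 0.

(* col_mx x (const_mx 1) is the (n+1)-tuple (x_1, ..., x_n, 1). *)
Definition totally_irrational (R : realType) (n : nat) (x : 'cV[R]_n) : Prop :=
  rationally_independent (col_mx x (const_mx 1 : 'cV[R]_1)).

Definition is_Zbasis (R : realType) (k : nat) (G : set R) (b : 'cV[R]_k) : Prop :=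
  G = [set r | exists c : 'I_k -> int, r = \sum_(i < k) (c i)%:~R * b i 0] /\
  (forall c : 'I_k -> int,
     \sum_(i < k) (c i)%:~R * b i 0 = 0 -> forall i, c i = 0).

(* G is a free abelian subgroup of R of rank k; k is unique since free abelian
   groups have invariant rank. *)
Definition has_rank (R : realType) (G : set R) (k : nat) : Prop :=
  exists b : 'cV[R]_k, is_Zbasis G b.

(* Main.v *)
Require Import Defs.
From mathcomp Require Import all_boot all_order all_algebra.
From mathcomp Require Import boolp classical_sets reals.
Set Implicit Arguments.
Unset Strict Implicit.
Unset Printing Implicit Defensive.
Import Order.TTheory GRing.Theory Num.Theory.
Local Open Scope classical_set_scope.
Local Open Scope ring_scope.

(** Homogenize: write [x^] for the column [(x_1, ..., x_n, 1)].  Then [G_x] is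
    the set of integer combinations of the entries of [x^], and the affine map
    [x |-> U x + t] becomes the linear map of [x^] given by the integer matrix
    [M = (U t; 0 1)], whose determinant is that of [U].

    Inclusions between groups of integer combinations are the same thing as
    integer matrices: every entry of [w] is an integer combination of those of
    [v] iff [w = A v] for some integer [A] ([Zspan_sub]).  If moreover the
    entries of [v] are independent over the integers, such an [A] is unique
    ([Zfree_inj]).  These two facts carry the whole proof.

    A map of the affine group changes [x^] by an invertible integer matrix,
    hence keeps [G_x].  Conversely, if [G_y = G_x] there are [M] and [N] of the
    above block shape with [y^ = M x^] and [x^ = N y^], so [N M x^ = x^], and
    total irrationality forces [N M = 1]; thus [det U = det M] is a unit of the
    integers, that is 1 or -1 ([orb_Ggroup]).

    The characterization by the rank is the same argument.  If [b] is a basis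
    of [G_x] with as many elements as [x^] has entries, then [b = A x^] and
    [x^ = B b] with [A], [B] square, [A B = 1] by independence of [b], hence
    also [B A = 1], and the independence of [b] passes to [x^]
    ([Zfree_same_span]).  Rational and integral independence agree by clearing
    denominators ([rationally_independentP]). *)

Local Notation toR A := (map_mx intr A).

Definition Zspan (R : realType) (k : nat) (v : 'cV[R]_k) : set R :=
  [set r | exists c : 'rV[int]_k, r = (toR c *m v) 0 0].

Definition Zfree (R : realType) (k : nat) (v : 'cV[R]_k) : Prop :=
  forall c : 'rV[int]_k, toR c *m v = 0 -> c = 0.

Lemma int_rowE (R : realType) (k : nat) (v : 'cV[R]_k) (c : 'rV[int]_k) :
  (toR c *m v) 0 0 = \sum_(i < k) (c 0 i)%:~R * v i 0.
Proof. by rewrite mxE; apply: eq_bigr => i _; rewrite mxE. Qed.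

Lemma int_funE (R : realType) (k : nat) (v : 'cV[R]_k) (c : 'I_k -> int) :
  \sum_(i < k) (c i)%:~R * v i 0 = (toR (\row_i c i) *m v) 0 0.
Proof. by rewrite int_rowE; apply: eq_bigr => i _; rewrite mxE. Qed.

Lemma mx11_eq0 (R : realType) (A : 'M[R]_1) : A 0 0 = 0 -> A = 0.
Proof. by move=> A0; apply/matrixP => i j; rewrite !ord1 A0 mxE. Qed.

Lemma Zspan_sub (R : realType) (m k : nat) (w : 'cV[R]_m) (v : 'cV[R]_k) :
  Zspan w `<=` Zspan v <-> exists A : 'M[int]_(m, k), w = toR A *m v.
Proof.
split=> [wv|[A ->] r [c ->]]; last first.
  by exists (c *m A); rewrite map_mxM mulmxA.
have row_i i : exists c : 'rV[int]_k, w i 0 = (toR c *m v) 0 0.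
  by apply: wv; exists (delta_mx 0 i); rewrite map_delta_mx -rowE mxE.
have [a aE] := choice row_i.
exists (\matrix_(i, j) a i 0 j); apply/matrixP => i j.
by rewrite ord1 aE int_rowE mxE; apply: eq_bigr => l _; rewrite !mxE.
Qed.

Lemma Zfree_inj (R : realType) (m k : nat) (v : 'cV[R]_k)
    (A B : 'M[int]_(m, k)) :
  Zfree v -> toR A *m v = toR B *m v -> A = B.
Proof.
move=> vfree AB; apply/row_matrixP => i; apply/eqP; rewrite -subr_eq0 -linearB.
apply/eqP/vfree; rewrite map_row -row_mul raddfB /= mulmxBl AB subrr.
exact: raddf0.
Qed.

Lemma Zbasis_Zspan (R : realType) (k : nat) (G : set R) (b : 'cV[R]_k) :
  is_Zbasis G b <-> G = Zspan b /\ Zfree b.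
Proof.
have spanE : [set r | exists c : 'I_k -> int,
    r = \sum_(i < k) (c i)%:~R * b i 0] = Zspan b.
  apply/seteqP; split=> r [c ->].
    by exists (\row_i c i); rewrite int_funE.
  by exists (c 0); rewrite int_rowE.
rewrite /is_Zbasis spanE; split=> -[-> bfree]; split=> // c c0.
  apply/rowP => i; rewrite mxE; apply: (bfree (c 0)).
  by rewrite -int_rowE c0 mxE.
move=> i; have /rowP/(_ i) : \row_i c i = 0.
  by apply: bfree; apply: mx11_eq0; rewrite -int_funE.
by rewrite !mxE.
Qed.

(** Because the transition matrices between [v] and [b] are square, the right
    inverse [A] of [B] is a left inverse as well; a left inverse is what lets
    a relation [c] on [v] be recovered from the relation [c B] on [b]. *)
Lemma Zfree_same_span (R : realType) (k : nat) (v b : 'cV[R]_k) :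
  Zspan v = Zspan b -> Zfree b -> Zfree v.
Proof.
move=> vb bfree.
have [|A bE] := (Zspan_sub b v).1; first by rewrite vb.
have [|B vE] := (Zspan_sub v b).1; first by rewrite vb.
have AB1 : A *m B = 1%:M.
  by apply: (Zfree_inj bfree); rewrite map_mxM -mulmxA -vE -bE map_mx1 mul1mx.
move=> c; rewrite vE mulmxA -map_mxM => /bfree cB0.
by rewrite -[c]mulmx1 -(mulmx1C AB1) mulmxA cB0 mul0mx.
Qed.

Lemma rationally_independentP (R : realType) (k : nat) (v : 'cV[R]_k) :
  rationally_independent v <-> Zfree v.
Proof.
split=> [vfree c c0|vfree q q0 i].
  apply/rowP => i; rewrite mxE; apply/eqP; rewrite -(intr_eq0 rat); apply/eqP.
  apply: (vfree (fun j => (c 0 j)%:~R)).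
  transitivity ((toR c *m v) 0 0); last by rewrite c0 mxE.
  by rewrite int_rowE; apply: eq_bigr => j _; rewrite ratr_int.
(* Multiplying a rational relation by the product [d] of its denominators gives
   the integer relation [c]. *)
pose d : int := \prod_j denq (q j).
have d_neq0 : d != 0 by apply/prodf_neq0 => j _; exact: denq_neq0.
pose c : 'rV[int]_k := \row_j (numq (q j) * \prod_(l | l != j) denq (q l)).
have cE j : (c 0 j)%:~R = d%:~R * q j :> rat.
  have -> : d = denq (q j) * \prod_(l | l != j) denq (q l).
    by rewrite /d (bigD1 j).
  by rewrite mxE !intrM numqE [RHS]mulrC mulrA.
have /rowP/(_ i) : c = 0.
  apply: vfree; apply: mx11_eq0; rewrite int_rowE.
  transitivity (d%:~R * \sum_(j < k) ratr (q j) * v j 0); last first.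
    by rewrite q0 mulr0.
  rewrite mulr_sumr; apply: eq_bigr => j _.
  by rewrite mulrA -(ratr_int R (c 0 j)) cE rmorphM /= ratr_int.
rewrite [RHS]mxE => ci0; apply/eqP; move: (cE i); rewrite ci0 => /esym/eqP.
by rewrite mulf_eq0 intr_eq0 (negPf d_neq0).
Qed.

Definition homog (R : realType) (n : nat) (x : 'cV[R]_n) : 'cV[R]_(n + 1) :=
  col_mx x (const_mx 1).

Definition affine_mx (n : nat) (U : 'M[int]_n) (t : 'cV[int]_n) :
  'M[int]_(n + 1) := block_mx U t 0 1%:M.

Lemma det_affine_mx (n : nat) (U : 'M[int]_n) (t : 'cV[int]_n) :
  \det (affine_mx U t) = \det U.
Proof. by rewrite det_ublock det1 mulr1. Qed.

Lemma const_mx11 (R : realType) : const_mx 1 = 1%:M :> 'M[R]_1.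
Proof. by apply/matrixP => i j; rewrite !ord1 !mxE. Qed.

Lemma homog_affine (R : realType) (n : nat) (U : 'M[int]_n) (t : 'cV[int]_n)
    (x : 'cV[R]_n) :
  homog (affine_map U t x) = toR (affine_mx U t) *m homog x.
Proof.
by rewrite /homog const_mx11 map_block_mx mul_block_col map_mx0 map_mx1 mul0mx
  !mulmx1 add0r.
Qed.

Lemma Ggroup_Zspan (R : realType) (n : nat) (x : 'cV[R]_n) :
  Ggroup x = Zspan (homog x).
Proof.
apply/seteqP; split=> [r [a0 [a ->]]|r [c ->]].
  exists (row_mx (\row_i a i) (const_mx a0)).
  rewrite map_row_mx mul_row_col const_mx11 mulmx1 mxE -int_funE !mxE.
  by rewrite addrC.
exists (c 0 (rshift n 0)), (fun i => c 0 (lshift 1 i)).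
rewrite int_rowE big_split_ord /= big_ord1 addrC /homog col_mxEd mxE mulr1.
by congr (_ + _); apply: eq_bigr => i _; rewrite col_mxEu.
Qed.

(** The inclusion gives some integer matrix sending [homog x] to [homog y];
    its rows for the entries of [y] are [(U t)], because the last entry of
    [homog x] is 1.  Its last row plays the role of [(0 1)], since the last
    entry of [homog y] is 1 too, so it can be discarded. *)
Lemma Ggroup_sub_affine (R : realType) (n : nat) (x y : 'cV[R]_n) :
  Ggroup y `<=` Ggroup x -> exists U t, y = affine_map U t x.
Proof.
rewrite !Ggroup_Zspan => /Zspan_sub[A yA].
exists (ulsubmx A), (ursubmx A); move: yA.
rewrite -{1}[A]submxK map_block_mx mul_block_col => /eq_col_mx[-> _].
by rewrite const_mx11 mulmx1.
Qed.

Lemma affine_Ggroup_sub (R : realType) (n : nat) (x : 'cV[R]_n)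
    (U : 'M[int]_n) (t : 'cV[int]_n) :
  Ggroup (affine_map U t x) `<=` Ggroup x.
Proof.
rewrite !Ggroup_Zspan; apply/Zspan_sub; exists (affine_mx U t).
exact: homog_affine.
Qed.

Lemma det_int_unitmx (n : nat) (U : 'M[int]_n) :
  U \in unitmx <-> \det U = 1 \/ \det U = -1.
Proof.
rewrite unitmxE; split=> [/pred2P|[] -> //]; exact.
Qed.

Lemma orb_Ggroup (R : realType) (n : nat) (x : 'cV[R]_n) :
  totally_irrational x -> orb x = [set y | Ggroup y = Ggroup x].
Proof.
move=> /rationally_independentP xfree; apply/seteqP; split=> y /=.
  case=> _ [U [t [/det_int_unitmx Uunit ->]]] ->.
  apply/seteqP; split; first exact: affine_Ggroup_sub.
  rewrite !Ggroup_Zspan; apply/Zspan_sub; exists (invmx (affine_mx U t)).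
  rewrite homog_affine mulmxA -map_mxM mulVmx ?map_mx1 ?mul1mx //.
  by rewrite unitmxE det_affine_mx -unitmxE.
move=> yx.
have [|U [t yE]] := @Ggroup_sub_affine R n x y; first by rewrite yx.
have [|V [s xE]] := @Ggroup_sub_affine R n y x; first by rewrite yx.
(* Freeness of [homog x] turns a relation at the point [x] into a matrix
   identity, so that the affine map sending [x] to [y] is invertible. *)
have VU1 : affine_mx V s *m affine_mx U t = 1%:M.
  apply: (Zfree_inj xfree).
  by rewrite map_mxM -mulmxA -homog_affine -yE -homog_affine -xE map_mx1 mul1mx.
exists (affine_map U t) => //; exists U, t; split=> //.
apply/det_int_unitmx; rewrite unitmxE -(det_affine_mx U t) -unitmxE.
by case/mulmx1_unit: VU1.
Qed.

Lemma totally_irrational_rank (R : realType) (n : nat) (x : 'cV[R]_n) :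
  totally_irrational x <-> has_rank (Ggroup x) n.+1.
Proof.
rewrite -addn1 /totally_irrational rationally_independentP Ggroup_Zspan.
split=> [xfree|[b /Zbasis_Zspan[xb bfree]]].
  by exists (homog x); apply/Zbasis_Zspan.
exact: Zfree_same_span xb bfree.
Qed.

Theorem proposition2p1 (R : realType) :
  (forall (n : nat) (x : 'cV[R]_n), (1 <= n)%N ->
     (totally_irrational x <-> has_rank (Ggroup x) n.+1) /\
     (totally_irrational x -> orb x = [set y | Ggroup y = Ggroup x])) /\
  (forall x : 'cV[R]_2, has_rank (Ggroup x) 3 ->
     orb x = [set y | Ggroup y = Ggroup x]).
Proof.
split=> [n x _|x /totally_irrational_rank]; last exact: orb_Ggroup.
by split; [exact: totally_irrational_rank | exact: orb_Ggroup].
Qed.
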